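(* Let $\theta>0$, $t>0$ and $k\in\mathbb{N}$. Define the Poissonised Charlier factorial moment by $$M^\theta(k;t)=\int\left(\int x(x-1)\cdots(x-k+1)\,\mathrm{d}\rho^\theta_{m+1}(x)\right)\mathrm{d}\mu^{t\theta}(m).$$ Then $M^\theta(k;t)$ can be written in terms of a Jacobi polynomial of degree $k$ in the variable $(1+t)(1-t)^{-1}$, with parameters $\alpha=1$ and $\beta=0$: $$M^\theta(k;t)=\theta^k\;{}_2F_1\left(\begin{matrix}-k,-k\\ 2\end{matrix};t\right)=\frac{\theta^k(1-t)^k}{k+1}P_k^{(1,0)}\left(\frac{1+t}{1-t}\right).$$
   Context: Conventions: $\mathbb{N}=\{0,1,2,\dots\}$; an empty product is $1$. Hypergeometric notation: $(a)_i=a(a+1)\cdots(a+i-1)$ and ${}_pF_q\left(\begin{matrix}a_1,\dots,a_p\\ b_1,\dots,b_q\end{matrix};z\right)=\sum_{i\ge0}\frac{(a_1)_i\cdots(a_p)_i}{(b_1)_i\cdots(b_q)_i}\frac{z^i}{i!}$, which terminates if some $a_j$ is a nonpositive integer. For $\theta>0$, the Poisson measure is $\mu^{\theta}(x)=\theta^xe^{-\theta}/x!$, $x\in\mathbb{N}$. The normalised Charlier polynomials are $c_n(x;\theta)=\sqrt{\theta^n/n!}\;{}_2F_0\left(\begin{matrix}-n,-x\\ -\end{matrix};-\frac1\theta\right)$, $n\in\mathbb{N}$. The Charlier one-point function with $N\ge1$ particles is the probability mass function on $\mathbb{N}$ given by $\rho_N^{\theta}(x)=\frac1N\sum_{n=0}^{N-1}c_n(x;\theta)^2\mu^\theta(x)$.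 Thus $M^\theta(k;t)=\sum_{m\ge0}e^{-t\theta}\frac{(t\theta)^m}{m!}\sum_{x\ge0}x(x-1)\cdots(x-k+1)\rho_{m+1}^\theta(x)$. The Jacobi polynomials are $P_n^{(\alpha,\beta)}(x)=\frac{(\alpha+1)_n}{n!}\;{}_2F_1\left(\begin{matrix}-n,n+\alpha+\beta+1\\ \alpha+1\end{matrix};\frac{1-x}{2}\right)$. The expression $(1-t)^kP_k^{(1,0)}\left(\frac{1+t}{1-t}\right)$ is a polynomial in $t$, and at $t=1$ it is understood as the value of this polynomial. *)

(* Defs.v *)
From HB Require Import structures.
From mathcomp Require Import all_boot all_order all_algebra.
From mathcomp Require Import all_classical all_reals all_analysis.

Set Implicit Arguments.
Unset Strict Implicit.
Unset Printing Implicit Defensive.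

Import Order.TTheory GRing.Theory Num.Theory.
Import numFieldNormedType.Exports.

Local Open Scope classical_set_scope.
Local Open Scope ring_scope.

Definition pochhammer (R : realType) (a : R) (i : nat) : R :=
  \prod_(j < i) (a + j%:R).

(* Intended for parameter lists [bs] without nonpositive integers, so that no
   denominator vanishes; the limit is then a finite sum as soon as some entry
   of [as_] is a nonpositive integer. *)
Definition hypergeometric (R : realType) (as_ bs : seq R) (z : R) : R :=
  limn (series (fun i : nat =>
    (\prod_(a <- as_) pochhammer a i) / (\prod_(b <- bs) pochhammer b i)
    * (z ^+ i / i`!%:R))).

Definition charlier (R : realType) (theta : R) (n x : nat) : R :=
  Num.sqrt (theta ^+ n / n`!%:R)
  * hypergeometric [:: - n%:R; - x%:R] [::] (- theta^-1).

Definition jacobi (R : realType) (n : nat) (alpha beta x : R) : R :=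
  pochhammer (alpha + 1) n / n`!%:R
  * hypergeometric [:: - n%:R; n%:R + alpha + beta + 1] [:: alpha + 1]
      ((1 - x) / 2).

(* The natural number argument of [poisson_prob] is a dummy: the measure does
   not depend on it. *)
Definition poisson_measure (R : realType) (theta : R) :
  {measure set nat -> \bar R} := poisson_prob theta 0.

Definition charlier_pmf (R : realType) (theta : R) (N x : nat) : R :=
  N%:R^-1 * \sum_(n < N) charlier theta n x ^+ 2 * poisson_pmf theta x.

Lemma charlier_pmf_ge0 (R : realType) (theta : R) (N x : nat) :
  0 <= charlier_pmf theta N x.
Proof.
apply: mulr_ge0; first by rewrite invr_ge0.
by apply: sumr_ge0 => n _; apply: mulr_ge0 (sqr_ge0 _) (poisson_pmf_ge0 _ _).
Qed.

Definition charlier_measure (R : realType) (theta : R) (N : nat) :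
  {measure set nat -> \bar R} :=
  mseries (fun x : nat =>
    mscale (NngNum (charlier_pmf_ge0 theta N x)) (\d_x)) 0.

(* [x ^_ k] is the falling factorial x(x-1)...(x-k+1).  The integrands are
   nonnegative, so the integral is defined in the extended reals without any
   integrability assumption. *)
Definition poissonised_charlier_moment (R : realType) (theta : R) (k : nat)
    (t : R) : \bar R :=
  (\int[poisson_measure (t * theta)]_m
     \int[charlier_measure theta m.+1]_x ((x ^_ k)%:R)%:E)%E.

(* Main.v *)
Require Import Defs.
From mathcomp Require Import all_boot all_order all_algebra.
From mathcomp Require Import all_classical all_reals all_analysis.
From mathcomp Require Import ring.

Set Implicit Arguments.
Unset Strict Implicit.
Unset Printing Implicit Defensive.

Import Order.TTheory GRing.Theory Num.Theory.
Import numFieldNormedType.Exports.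
Local Open Scope ring_scope.

(* With [X] Poisson of parameter [theta], [E[X^_k g(X)] = theta^k E[g(X + k)]].
   Since the forward difference lowers the degree of a Charlier polynomial,
   [c_n(X + k)] expands in the orthogonal family [c_(n-j)(X)], [j <= k], and so
   [E[X^_k c_n(X)^2] = theta^k \sum_j C(k,j)^2 n^_j / theta^j].  Averaging over
   [n <= m] turns [n^_j] into [m^_j / (j+1)], whose mean under the Poisson law
   of parameter [t theta] is [(t theta)^j / (j+1)]: this gives the 2F1.  The
   Jacobi form is Pfaff's transformation, which here reduces to Vandermonde's
   identity and the binomial theorem. *)

(** * Binomial and falling factorial sums *)

Lemma sum_ffact (j N : nat) :
  (j.+1 * \sum_(n < N) n ^_ j = N ^_ j.+1)%N.
Proof.
elim: N => [|N IHN]; first by rewrite big_ord0 muln0.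
rewrite big_ord_recr /= mulnDr IHN ffactSS ffactnSr.
rewrite [X in (X + _)%N]mulnC -mulnDl.
have [le_jN | lt_Nj] := leqP j N; first by rewrite addnS subnK.
by rewrite ffact_small // !muln0.
Qed.

(** Either side multiplied by l! (i - l)! (k - i)! is k!. *)
Lemma bin_mul_trinomial (k i l : nat) : (l <= i <= k)%N ->
  ('C(k, i) * 'C(i, l) = 'C(k, l) * 'C(k - l, i - l))%N.
Proof.
case/andP=> le_li le_ik.
have pos : (0 < l`! * (i - l)`! * (k - i)`!)%N by rewrite !muln_gt0 !fact_gt0.
apply/eqP; rewrite -(eqn_pmul2r pos); apply/eqP.
have e1 := bin_fact le_ik; have e2 := bin_fact le_li.
have e3 := bin_fact (leq_trans le_li le_ik).
have e4 := @bin_fact (k - l) (i - l) (leq_sub2r _ le_ik).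
rewrite subnBA // subnK // in e4; last exact: leq_trans le_ik.
transitivity (k`!).
  by rewrite -e1 -e2; ring.
by rewrite -e3 -e4; ring.
Qed.

(** [bin_mul_trinomial] takes ['C(k, l)] out of the sum, and what remains is the binomial expansion
    of (r + s)^(k - l). *)
Lemma sum_bin_mul (R : comPzRingType) (k l : nat) (s r : R) : (l <= k)%N ->
  \sum_(i < k.+1) ('C(k, i) * 'C(i, l))%:R * (s ^+ i * r ^+ (k - i))
  = 'C(k, l)%:R * (s ^+ l * (r + s) ^+ (k - l)).
Proof.
move=> le_lk.
pose F i := ('C(k, i) * 'C(i, l))%:R * (s ^+ i * r ^+ (k - i)).
rewrite -(big_mkord xpredT F) {}/F.
rewrite (big_cat_nat (n := l)) //=; last exact: leqW.
rewrite big_nat big1 ?add0r => [|i /andP[_ lt_il]]; last first.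
  by rewrite (bin_small lt_il) muln0 mul0r.
rewrite -{1}[l]add0n big_addn subSn // big_mkord exprDn !mulr_sumr.
apply: eq_bigr => i _; have le_i : (i <= k - l)%N by rewrite -ltnS.
rewrite bin_mul_trinomial; last by rewrite leq_addl addnC -leq_subRL.
rewrite addnK natrM exprD -mulr_natr [(i + l)%N]addnC subnDA.
ring.
Qed.

(** Pascal's rule; it drives the induction on the size of the shift in [charlier_sum_shift]. *)
Lemma sum_bin_recr (R : pzRingType) (k : nat) (a : nat -> R) :
  \sum_(j < k.+1) 'C(k, j)%:R * (a j + a j.+1)
  = \sum_(j < k.+2) 'C(k.+1, j)%:R * a j.
Proof.
rewrite [RHS]big_ord_recl /= bin0.
under [X in _ = _ + X]eq_bigr do rewrite /bump /= add1n binS natrD mulrDl.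
under [LHS]eq_bigr do rewrite mulrDr.
rewrite !big_split /= addrA; congr (_ + _).
rewrite big_ord_recl /= bin0 big_ord_recr /= bin_small // mul0r addr0.
by congr (_ + _).
Qed.

(** * Unnormalised Charlier polynomials *)

Section charlier_sum.
Variables (R : numFieldType) (r : R).

(** For r = -1/theta this is the 2F0 of the Charlier polynomial, the signs of (-n)_i and (-x)_i
    having cancelled. The square root factor is left out, which makes the sum symmetric in [n] and
    [x]. *)
Definition charlier_sum (n x : nat) : R :=
  \sum_(i < n.+1) (n ^_ i)%:R * (x ^_ i)%:R * (r ^+ i / i`!%:R).

Lemma charlier_sum_widen (n x M : nat) : (n <= M)%N ->
  charlier_sum n x =
  \sum_(i < M.+1) (n ^_ i)%:R * (x ^_ i)%:R * (r ^+ i / i`!%:R).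
Proof.
move=> le_nM; pose F i : R := (n ^_ i)%:R * (x ^_ i)%:R * (r ^+ i / i`!%:R).
rewrite /charlier_sum -!(big_mkord xpredT F) [RHS](big_cat_nat (n := n.+1)) //=.
rewrite [X in _ + X]big_nat [X in _ + X]big1 ?addr0 // => i /andP[lt_ni _].
by rewrite /F ffact_small // !mul0r.
Qed.

Lemma charlier_sumC (n x : nat) : charlier_sum n x = charlier_sum x n.
Proof.
rewrite (@charlier_sum_widen n x (n + x)) ?leq_addr //.
rewrite (@charlier_sum_widen x n (n + x)) ?leq_addl //.
by apply: eq_bigr => i _; rewrite (mulrC (n ^_ i)%:R).
Qed.

(** Termwise, n + 1 = (n - i) + (i + 1) splits the factor gained by the falling factorial of n + 1.
    At x = 0 the value of [x.-1] is irrelevant because of the factor [x%:R]. *)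
Lemma charlier_sumSl (n x : nat) :
  charlier_sum n.+1 x = charlier_sum n x + r * (x%:R * charlier_sum n x.-1).
Proof.
rewrite (@charlier_sum_widen n x n.+1) // [LHS]big_ord_recl.
rewrite [X in _ = X + _]big_ord_recl -[RHS]addrA; congr (_ + _).
rewrite !mulr_sumr -big_split /=; apply: eq_bigr => i _.
rewrite /bump /= add1n ffactSS [n ^_ i.+1]ffactnSr [x ^_ i.+1]ffactnS.
rewrite exprS factS !natrM.
rewrite natrB -1?ltnS // invfM -!(natr1 i) -(natr1 n).
have i1 : (i%:R + 1 : R) != 0 by rewrite natr1 pnatr_eq0.
have fi : (i`!%:R : R) != 0 by rewrite pnatr_eq0 -lt0n fact_gt0.
by field; rewrite i1 fi.
Qed.

(* The self-duality [charlier_sumC] turns the recurrence in the degree into the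
   forward difference formula. *)
Lemma charlier_sumSr (n x : nat) :
  charlier_sum n x.+1 = charlier_sum n x + r * (n%:R * charlier_sum n.-1 x).
Proof. by rewrite !(charlier_sumC n) charlier_sumSl (charlier_sumC n.-1). Qed.

(** Iterated forward difference formula. When j > n the truncated [n - j] is harmless, since
    [n ^_ j] vanishes. *)
Lemma charlier_sum_shift (n x k : nat) :
  charlier_sum n (x + k) =
  \sum_(j < k.+1)
    'C(k, j)%:R * (r ^+ j * (n ^_ j)%:R * charlier_sum (n - j) x).
Proof.
elim: k x => [|k IHk] x.
  by rewrite addn0 big_ord1 bin0 subn0 ffactn0 expr0 !mul1r.
pose a j := r ^+ j * (n ^_ j)%:R * charlier_sum (n - j) x.
rewrite addnS -addSn IHk -(sum_bin_recr k a).
apply: eq_bigr => j _; congr (_ * _); rewrite {}/a charlier_sumSr.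
rewrite exprSr ffactnSr natrM subnS; ring.
Qed.

End charlier_sum.

(** * Terminating hypergeometric series as finite sums *)

Lemma limn_series_finite (R : realType) (u : nat -> R) (n : nat) :
  (forall i, (n < i)%N -> u i = 0) ->
  limn (series u) = \sum_(i < n.+1) u i.
Proof.
move=> u0; apply: cvg_lim => //; apply: cvg_near_cst.
exists n.+1 => // m /= lt_nm; rewrite /series /= -(big_mkord xpredT).
rewrite [LHS](big_cat_nat (n := n.+1)) //=.
rewrite [X in _ + X]big_nat [X in _ + X]big1 ?addr0 // => i /andP[lt_ni _].
exact: u0.
Qed.

Section pochhammer.
Variable R : realType.

Lemma pochhammerN (n i : nat) :
  pochhammer (- n%:R : R) i = (-1) ^+ i * (n ^_ i)%:R.
Proof.
elim: i => [|i IHi]; first by rewrite /pochhammer big_ord0 mulr1.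
rewrite /pochhammer big_ord_recr /= -[X in X * _]/(pochhammer _ _) IHi.
rewrite ffactnSr natrM exprSr.
have [le_in | lt_ni] := leqP i n; first by rewrite natrB //; ring.
by rewrite ffact_small // !(mulr0, mul0r).
Qed.

Lemma pochhammerS (n i : nat) :
  pochhammer (n.+1%:R : R) i = (n + i)`!%:R / n`!%:R.
Proof.
have fn0 : (n`!%:R : R) != 0 by rewrite pnatr_eq0 -lt0n fact_gt0.
elim: i => [|i IHi]; first by rewrite /pochhammer big_ord0 addn0 divff.
rewrite /pochhammer big_ord_recr /= -[X in X * _]/(pochhammer _ _) IHi.
by rewrite addnS factS natrM -addSn natrD; field.
Qed.

End pochhammer.

Lemma hypergeometric_terminating (R : realType) (n : nat) (b : R) (bs : seq R)
    (z : R) :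
  hypergeometric [:: - n%:R; b] bs z =
  \sum_(i < n.+1) ((-1) ^+ i * (n ^_ i)%:R * pochhammer b i
    / (\prod_(c <- bs) pochhammer c i) * (z ^+ i / i`!%:R)).
Proof.
rewrite /hypergeometric (@limn_series_finite _ _ n) => [|i lt_ni].
  by apply: eq_bigr => i _; rewrite big_cons big_seq1 pochhammerN.
by rewrite big_cons big_seq1 pochhammerN ffact_small // !(mulr0, mul0r).
Qed.

Lemma charlierE (R : realType) (theta : R) (n x : nat) :
  charlier theta n x =
  Num.sqrt (theta ^+ n / n`!%:R) * charlier_sum (- theta^-1) n x.
Proof.
rewrite /charlier hypergeometric_terminating; congr (_ * _).
apply: eq_bigr => i _; rewrite big_nil divr1 pochhammerN; congr (_ * _).
by rewrite mulrACA mulrA -!mulrA signrMK.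
Qed.

(** Since (2)_j = (j + 1)!, dividing the square of [k ^_ j] by (2)_j j! leaves the squared binomial
    over j + 1. *)
Lemma hypergeometric_NN2 (R : realType) (k : nat) (t : R) :
  hypergeometric [:: - k%:R; - k%:R] [:: 2] t =
  \sum_(j < k.+1) 'C(k, j)%:R ^+ 2 / j.+1%:R * t ^+ j.
Proof.
rewrite hypergeometric_terminating; apply: eq_bigr => j _.
rewrite big_seq1 pochhammerN pochhammerS add1n divr1 factS.
rewrite -bin_ffact !natrM.
have fj : (j`!%:R : R) != 0 by rewrite pnatr_eq0 -lt0n fact_gt0.
transitivity ((-1) ^+ j * (-1) ^+ j * ('C(k, j)%:R ^+ 2 / j.+1%:R * t ^+ j)).
  by field; rewrite fj nat1r pnatr_eq0.
by rewrite -expr2 sqrr_sign mul1r.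
Qed.

Lemma jacobi_transform (R : realType) (k : nat) (s : R) : s != 1 ->
  (1 - s) ^+ k * jacobi k 1 0 ((1 + s) / (1 - s)) =
  \sum_(j < k.+1) ('C(k, j) * 'C(k.+1, j.+1))%:R * s ^+ j.
Proof.
move=> s1; have s1' : 1 - s != 0 by rewrite subr_eq0 eq_sym.
(* The Jacobi argument becomes -s/(1 - s), whose sign cancels that of (-k)_i, and (1 - s)^k clears
   the denominators. The ratio (2)_k (k + 2)_i / (k! (2)_i) is ['C(i + k.+1, k)]. *)
transitivity (\sum_(i < k.+1)
    ('C(k, i) * 'C(i + k.+1, k))%:R * (s ^+ i * (1 - s) ^+ (k - i))).
  have e2 : 1 + 1 = 2%:R :> R by [].
  have ek : k%:R + 1 + 0 + 1 = k.+2%:R :> R by rewrite addr0 !natr1.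
  have ez : (1 - (1 + s) / (1 - s)) / 2 = - (s / (1 - s)) by field.
  rewrite /jacobi {}e2 {}ek {}ez hypergeometric_terminating.
  rewrite !mulr_sumr; apply: eq_bigr => i _.
  have le_ik : (i <= k)%N by rewrite -ltnS.
  rewrite big_seq1 !pochhammerS divr1 !add1n -bin_ffact.
  have le_k : (k <= i + k.+1)%N by rewrite addnS leqW // leq_addl.
  rewrite [(k.+1 + i)%N]addnC -(bin_fact le_k).
  rewrite (_ : (i + k.+1 - k)%N = i.+1); last by rewrite addnS -addSn addnK.
  rewrite !factS fact0.
  rewrite -{1}(subnK le_ik) exprD (exprNn (s / _)) exprMn exprVn !natrM.
  have fact_neq0 m : (m`!%:R : R) != 0 by rewrite pnatr_eq0 -lt0n fact_gt0.
  have s1i : (1 - s) ^+ i != 0 by rewrite expf_neq0.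
  have sgn : (-1) ^+ i * (-1) ^+ i = 1 :> R by rewrite -expr2 sqrr_sign.
  rewrite -[RHS]mul1r -[X in _ = X * _]sgn.
  have nz (m : nat) : 1 + m%:R != 0 :> R by rewrite nat1r pnatr_eq0.
  by field; rewrite !fact_neq0 s1i !nz.
(* Vandermonde writes ['C(i + k.+1, k)] as a sum over l of ['C(i, l) * 'C(k.+1, k - l)]. The sum
   over i is then [sum_bin_mul] with r = 1 - s, so that r + s = 1. *)
under eq_bigr => i _.
  rewrite -binomial.Vandermonde big_distrr natr_sum mulr_suml; over.
rewrite exchange_big /=; apply: eq_bigr => l _.
have le_lk : (l <= k)%N by rewrite -ltnS.
under eq_bigr do rewrite mulnA natrM mulrAC.
rewrite -mulr_suml sum_bin_mul // subrK expr1n mulr1 natrM mulrAC.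
by rewrite -(@bin_sub k.+1 l.+1) // subSS.
Qed.

(** * Expectations under the Poisson law *)

Section poisson_mean.
Variables (R : realType) (theta : R).
Hypothesis theta_gt0 : 0 < theta.
Local Open Scope classical_set_scope.

(** A relation rather than a value, so that convergence is carried along with the limit through
    linear combinations. *)
Definition poisson_mean (f : nat -> R) (l : R) : Prop :=
  series (fun x => f x * poisson_pmf theta x) n @[n --> \oo] --> l.

Lemma eq_poisson_mean (f g : nat -> R) (l : R) :
  f =1 g -> poisson_mean f l -> poisson_mean g l.
Proof. by move=> /funext ->. Qed.

Lemma poisson_meanD (f g : nat -> R) (a b : R) :
  poisson_mean f a -> poisson_mean g b ->
  poisson_mean (fun x => f x + g x) (a + b).
Proof.
move=> fa gb; rewrite /poisson_mean (_ : series _ =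
    series (fun x => f x * poisson_pmf theta x) +
    series (fun x => g x * poisson_pmf theta x)); first exact: cvgD.
by rewrite -seriesD; congr series; apply/funext => x; rewrite mulrDl.
Qed.

Lemma poisson_meanZ (c : R) (f : nat -> R) (a : R) :
  poisson_mean f a -> poisson_mean (fun x => c * f x) (c * a).
Proof.
move=> fa; rewrite /poisson_mean (_ : series _ =
    c *: series (fun x => f x * poisson_pmf theta x)); first exact: cvgZr.
by rewrite -seriesZ; congr series; apply/funext => x; rewrite -mulrA.
Qed.

Lemma poisson_mean0 : poisson_mean (fun=> 0) 0.
Proof.
rewrite /poisson_mean (_ : series _ = fun=> 0); first exact: cvg_cst.
by apply/funext => n; rewrite /series /= big1 // => x _; rewrite mul0r.
Qed.

Lemma poisson_mean_sum (I : Type) (s : seq I) (f : I -> nat -> R) (a : I -> R) :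
  (forall i, poisson_mean (f i) (a i)) ->
  poisson_mean (fun x => \sum_(i <- s) f i x) (\sum_(i <- s) a i).
Proof.
move=> fa; elim: s => [|i s IHs].
  rewrite big_nil; apply: eq_poisson_mean poisson_mean0 => x.
  by rewrite big_nil.
rewrite big_cons; apply: eq_poisson_mean (poisson_meanD (fa i) IHs) => x.
by rewrite big_cons.
Qed.

Lemma poisson_mean1 : poisson_mean (fun=> 1) 1.
Proof.
rewrite /poisson_mean (_ : series _ =
    expR (- theta) *: series (exp_coeff theta)).
  rewrite -[X in _ --> X](mulVf (x := expR theta)) ?expR_eq0 // -expRN.
  exact: cvgZr (is_cvg_series_exp_coeff theta).
rewrite -seriesZ; congr series; apply/funext => x.
by rewrite mul1r /poisson_pmf theta_gt0 mulrC /exp_coeff.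
Qed.

(* [x mu(x) = theta mu(x - 1)] *)
Lemma poisson_mean_mul (f : nat -> R) (l : R) :
  poisson_mean f l -> poisson_mean (fun x => x%:R * f x.-1) (theta * l).
Proof.
(* The term at x = 0 vanishes, so partial sums are compared after a shift by one. *)
move=> fl; rewrite /poisson_mean -cvg_shiftS.
rewrite (_ : (fun n => _) =
  theta *: series (fun x => f x * poisson_pmf theta x)); first exact: cvgZr.
apply/funext => n; rewrite -seriesZ.
rewrite /series /= big_nat_recl // mul0r mul0r add0r.
apply: eq_bigr => x _; rewrite /poisson_pmf theta_gt0 factS exprS natrM /=.
rewrite -[RHS]/(theta * (f x * (theta ^+ x / x`!%:R * expR (- theta)))).
have fx : (x`!%:R : R) != 0 by rewrite pnatr_eq0 -lt0n fact_gt0.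
by field; rewrite fx nat1r pnatr_eq0.
Qed.

Lemma poisson_mean_ffact (k : nat) (f : nat -> R) (l : R) :
  poisson_mean (fun x => f (x + k)%N) l ->
  poisson_mean (fun x => (x ^_ k)%:R * f x) (theta ^+ k * l).
Proof.
elim: k f l => [|k IHk] f l fl.
  rewrite expr0; apply: eq_poisson_mean (poisson_meanZ (c := 1) fl) => x.
  by rewrite addn0.
have /poisson_mean_mul :
    poisson_mean (fun x => (x ^_ k)%:R * f x.+1) (theta ^+ k * l).
  apply: (IHk (fun x => f x.+1)); apply: eq_poisson_mean fl => x.
  by rewrite addnS.
rewrite mulrA -exprS; apply: eq_poisson_mean => -[|x].
  by rewrite ffactnS mul0n !mul0r.
by rewrite ffactnS natrM mulrA.
Qed.

Lemma poisson_mean_ffact1 (j : nat) :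
  poisson_mean (fun x => (x ^_ j)%:R) (theta ^+ j).
Proof.
rewrite -[X in poisson_mean _ X]mulr1.
apply: eq_poisson_mean (poisson_mean_ffact (f := fun=> 1) poisson_mean1) => x.
by rewrite mulr1.
Qed.

Local Notation r := (- theta^-1).
Local Notation K := (charlier_sum r).

(* The recurrence [charlier_sumSl] says that the adjoint of the raising operator
   [K n -> K n.+1] is minus the forward difference, which lowers [K m]. *)
Lemma charlier_sum_orthogonal (n m : nat) :
  poisson_mean (fun x => K n x * K m x)
    (if n == m then n`!%:R / theta ^+ n else 0).
Proof.
have theta0 : theta != 0 by rewrite gt_eqF.
elim: n m => [|n IHn] m.
  apply: (@eq_poisson_mean (K m)).
    move=> x; rewrite [X in X * _]/charlier_sum big_ord1.
    by rewrite !ffactn0 divr1 !mul1r.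
  rewrite (_ : (if _ then _ else _) = \sum_(i < m.+1)
      (m ^_ i)%:R * (r ^+ i / i`!%:R) * theta ^+ i).
    apply: (@eq_poisson_mean (fun x => \sum_(i < m.+1)
        (m ^_ i)%:R * (r ^+ i / i`!%:R) * (x ^_ i)%:R)).
      by move=> x; apply: eq_bigr => i _; rewrite mulrAC.
    apply: poisson_mean_sum => i; exact/poisson_meanZ/poisson_mean_ffact1.
  (* As r theta = -1, the mean of [K m] is the alternating sum of the binomials ['C(m, i)]. *)
  transitivity ((1 - 1 : R) ^+ m).
    by rewrite subrr expr0n expr0 fact0 divr1 eq_sym; case: eqP.
  rewrite exprDn; apply: eq_bigr => i _.
  have fi : (i`!%:R : R) != 0 by rewrite pnatr_eq0 -lt0n fact_gt0.
  rewrite -bin_ffact natrM expr1n mul1r -mulr_natl (exprNn theta^-1) exprVn.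
  by field; rewrite fi expf_neq0.
have step : poisson_mean (fun x => K n x * K m x.+1)
   ((if n == m then n`!%:R / theta ^+ n else 0) +
    r * m%:R * (if n == m.-1 then n`!%:R / theta ^+ n else 0)).
  have IHm1 := poisson_meanZ (c := r * m%:R) (IHn m.-1).
  apply: eq_poisson_mean (poisson_meanD (IHn m) IHm1) => x.
  by rewrite charlier_sumSr; ring.
have := poisson_meanD (IHn m) (poisson_meanZ (c := r) (poisson_mean_mul step)).
rewrite (_ : _ + r * _ = if n.+1 == m then n.+1`!%:R / theta ^+ n.+1 else 0).
  apply: eq_poisson_mean => -[|x]; rewrite charlier_sumSl /=; ring.
(* Since r theta = -1, the mean of [K n x * K m x] cancels and only the difference term of [step]
   survives. For m = 0 that term has the factor [m%:R], so [m.-1] does no harm. *)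
rewrite mulrA mulNr mulVf // mulN1r opprD addrA subrr add0r.
case: m {IHn step} => [|m] /=; first by rewrite mulr0 mul0r oppr0.
rewrite eqSS; case: eqP => [<-|_]; last by rewrite mulr0 oppr0.
by rewrite factS natrM exprS; field; rewrite theta0 expf_neq0.
Qed.

(** Square the expansion of [charlier_sum_shift]: orthogonality keeps the diagonal, where [n ^_ j]
    times (n - j)! is n!. *)
Lemma poisson_mean_charlier_sum_shift (n k : nat) :
  poisson_mean (fun x => K n (x + k) ^+ 2)
    (\sum_(j < k.+1) 'C(k, j)%:R ^+ 2 *
       (n`!%:R / theta ^+ n * (n ^_ j)%:R / theta ^+ j)).
Proof.
have theta0 : theta != 0 by rewrite gt_eqF.
pose c j : R := 'C(k, j)%:R * (r ^+ j * (n ^_ j)%:R).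
pose d i j : R :=
  if (n - i == n - j)%N then (n - i)`!%:R / theta ^+ (n - i) else 0.
have -> : \sum_(j < k.+1) 'C(k, j)%:R ^+ 2 *
     (n`!%:R / theta ^+ n * (n ^_ j)%:R / theta ^+ j) =
   \sum_(i < k.+1) \sum_(j < k.+1) c i * c j * d i j.
  apply: eq_bigr => i _; rewrite (bigD1 i) //=.
  rewrite big1 ?addr0 => [|j /negbTE ne_ji].
    rewrite /d eqxx /c.
    have [le_in | lt_ni] := leqP i n; last first.
      by rewrite (ffact_small lt_ni) !(mulr0, mul0r).
    have ef : n`!%:R = (n ^_ i)%:R * (n - i)`!%:R :> R.
      by rewrite -natrM ffact_fact.
    have et : theta ^+ n = theta ^+ (n - i) * theta ^+ i.
      by rewrite -exprD subnK.
    rewrite ef et exprNn exprVn -[LHS]mul1r -[X in X * _ = _](sqrr_sign R i).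
    by field; rewrite !expf_neq0.
  rewrite /d; case: eqP => [e|_]; last by rewrite mulr0.
  (* Truncated subtraction lets n - i = n - j hold for distinct i and j only if one of them exceeds
     n, and then its coefficient [c] is zero. *)
  have [lt_ni | le_in] := ltnP n i.
    by rewrite /c (ffact_small lt_ni) !(mulr0, mul0r).
  have [lt_nj | le_jn] := ltnP n j.
    by rewrite /c (ffact_small lt_nj) !(mulr0, mul0r).
  by move: ne_ji; rewrite -val_eqE /= -(subKn le_in) -(subKn le_jn) e eqxx.
apply: (@eq_poisson_mean (fun x => \sum_(i < k.+1) \sum_(j < k.+1)
    c i * c j * (K (n - i) x * K (n - j) x))).
  move=> x; rewrite charlier_sum_shift expr2 big_distrlr /=.
  by apply: eq_bigr => i _; apply: eq_bigr => j _; rewrite /c; ring.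
apply: poisson_mean_sum => i; apply: poisson_mean_sum => j.
exact/poisson_meanZ/charlier_sum_orthogonal.
Qed.

Lemma poisson_mean_ffact_charlier (n k : nat) :
  poisson_mean (fun x => (x ^_ k)%:R * charlier theta n x ^+ 2)
    (theta ^+ k *
     \sum_(j < k.+1) 'C(k, j)%:R ^+ 2 * ((n ^_ j)%:R / theta ^+ j)).
Proof.
have theta0 : theta != 0 by rewrite gt_eqF.
apply: poisson_mean_ffact.
(* The square of the normalising factor; it cancels the squared norm n!/theta^n of [K n]. *)
pose a : R := theta ^+ n / n`!%:R.
have a_ge0 : 0 <= a by rewrite divr_ge0 // exprn_ge0 // ltW.
have -> : \sum_(j < k.+1) 'C(k, j)%:R ^+ 2 * ((n ^_ j)%:R / theta ^+ j) =
  a * \sum_(j < k.+1) 'C(k, j)%:R ^+ 2 *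
    (n`!%:R / theta ^+ n * (n ^_ j)%:R / theta ^+ j).
  rewrite mulr_sumr; apply: eq_bigr => j _.
  have fn : (n`!%:R : R) != 0 by rewrite pnatr_eq0 -lt0n fact_gt0.
  by rewrite /a; field; rewrite fn !expf_neq0.
apply: eq_poisson_mean
  (poisson_meanZ (c := a) (@poisson_mean_charlier_sum_shift n k)) => x.
by rewrite charlierE exprMn sqr_sqrtr.
Qed.

Lemma charlier_pmf_moment (m k : nat) :
  series (fun x => (x ^_ k)%:R * charlier_pmf theta m.+1 x) n @[n --> \oo] -->
  (theta ^+ k * \sum_(j < k.+1)
     'C(k, j)%:R ^+ 2 / (j.+1%:R * theta ^+ j) * (m ^_ j)%:R).
Proof.
have theta0 : theta != 0 by rewrite gt_eqF.
have := poisson_meanZ (c := m.+1%:R^-1) (poisson_mean_sum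
  (s := index_enum 'I_m.+1)
  (fun n : 'I_m.+1 => @poisson_mean_ffact_charlier n k)).
rewrite /poisson_mean (_ : series _ =
    series (fun x => (x ^_ k)%:R * charlier_pmf theta m.+1 x)); last first.
  congr series; apply/funext => x; rewrite /charlier_pmf -mulr_suml -mulr_sumr.
  by rewrite !mulrA (mulrC (_ ^-1)).
congr (_ --> _).
rewrite -mulr_sumr mulrCA; congr (_ * _); rewrite exchange_big mulr_sumr /=.
apply: eq_bigr => j _; rewrite -mulr_sumr -mulr_suml -natr_sum.
(* The factor m + 1 split off by [ffactSS] cancels the 1/(m + 1) of the average. *)
have := sum_ffact j m.+1; rewrite ffactSS => /(congr1 (fun i => i%:R : R)).
rewrite !natrM => e.
have j0 : (j.+1%:R : R) != 0 by rewrite pnatr_eq0.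
have m0 : (m.+1%:R : R) != 0 by rewrite pnatr_eq0.
transitivity ('C(k, j)%:R ^+ 2 / (j.+1%:R * m.+1%:R * theta ^+ j) *
    (j.+1%:R * (\sum_(n < m.+1) n ^_ j)%:R)).
  by field; rewrite !nat1r m0 j0 expf_neq0.
by rewrite e; field; rewrite !nat1r m0 j0 expf_neq0.
Qed.

End poisson_mean.

(** * Integrals of nonnegative functions as series *)

Lemma eseries_EFin_cvg (R : realType) (u : nat -> R) (l : R) :
  (series u n @[n --> \oo] --> l)%classic ->
  (\sum_(0 <= n <oo) (u n)%:E = l%:E)%E.
Proof.
move=> ul; rewrite -(cvg_lim _ ul) // -EFin_lim; last by apply/cvg_ex; exists l.
by apply/congr_lim/funext => n; rewrite /= /series /= sumEFin.
Qed.

Section nat_integral.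
Variables (R : realType) (f : nat -> R) (l : R).
Hypothesis f_ge0 : forall n, 0 <= f n.

Let f_ge0E (n : nat) : (0 <= (f n)%:E)%E. Proof. by rewrite lee_fin. Qed.

Lemma integral_poisson_measure (theta : R) : 0 < theta ->
  (series (fun n => f n * poisson_pmf theta n) n @[n --> \oo] --> l)%classic ->
  (\int[poisson_measure theta]_n (f n)%:E = l%:E)%E.
Proof.
move=> theta_gt0 fl.
(* Cut into singletons, on each of which the integrand is constant and the measure is one value of
   the mass function. *)
have -> : [set: nat]%classic = (\bigcup_n [set n])%classic.
  by apply/seteqP; split => // n _; exists n.
rewrite ge0_integral_bigcup //; last first.
  by move=> i j _ _ [n [/= <- <-]].
rewrite -(eseries_EFin_cvg fl); apply: eq_eseriesr => n _.
rewrite (eq_integral (cst (f n)%:E)) => [|x /[1!inE] /= -> //].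
rewrite integral_cst // /poisson_measure /= /poisson_prob theta_gt0.
by rewrite esum_set1 ?lee_fin ?poisson_pmf_ge0 // EFinM.
Qed.

Lemma integral_charlier_measure (theta : R) (N : nat) :
  (series (fun n => f n * charlier_pmf theta N n) n
     @[n --> \oo] --> l)%classic ->
  (\int[charlier_measure theta N]_n (f n)%:E = l%:E)%E.
Proof.
move=> fl; rewrite /charlier_measure ge0_integral_measure_series //.
rewrite -(eseries_EFin_cvg fl); apply: eq_eseriesr => n _.
rewrite ge0_integral_mscale // integral_dirac //.
by rewrite diracT mul1e -EFinM mulrC.
Qed.

End nat_integral.

(** * The Poissonised moment and its closed forms *)

Lemma poissonised_charlier_momentE (R : realType) (theta t : R) (k : nat) :
  0 < theta -> 0 < t ->
  poissonised_charlier_moment theta k t =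
  (theta ^+ k * \sum_(j < k.+1) 'C(k, j)%:R ^+ 2 / j.+1%:R * t ^+ j)%:E.
Proof.
move=> theta_gt0 t_gt0; have theta0 : theta != 0 by rewrite gt_eqF.
have tt_gt0 : 0 < t * theta by rewrite mulr_gt0.
rewrite /poissonised_charlier_moment.
pose c j : R := 'C(k, j)%:R ^+ 2 / (j.+1%:R * theta ^+ j).
under eq_integral => m _.
  rewrite (integral_charlier_measure _
    (charlier_pmf_moment theta_gt0 (m := m) (k := k))) //; over.
apply: integral_poisson_measure => // [m|].
  rewrite mulr_ge0 ?exprn_ge0 ?(ltW theta_gt0) // sumr_ge0 // => j _.
  by rewrite mulr_ge0 // divr_ge0 ?mulr_ge0 ?exprn_ge0 ?(ltW theta_gt0).
apply: (poisson_meanZ (c := theta ^+ k)).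
(* The j-th factorial moment of the outer law is (t theta)^j; its theta^j cancels against the
   denominator of [c j]. *)
rewrite (_ : \sum_(j < k.+1) _ = \sum_(j < k.+1) c j * (t * theta) ^+ j).
  by apply: poisson_mean_sum => j; exact/poisson_meanZ/poisson_mean_ffact1.
apply: eq_bigr => j _; rewrite /c exprMn.
by field; rewrite nat1r pnatr_eq0 expf_neq0.
Qed.

(* [p] is the (unique) polynomial that [(1 - s)^k P_k^(1,0)((1+s)/(1-s))]
   coincides with for [s != 1], and [p.[t]] gives that expression its meaning
   also at [t = 1]. *)
Theorem theorem6 (R : realType) (theta t : R) (k : nat)
    (theta_gt0 : 0 < theta) (t_gt0 : 0 < t) :
  poissonised_charlier_moment theta k t =
    (theta ^+ k * hypergeometric [:: - k%:R; - k%:R] [:: 2] t)%:E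
  /\ exists p : {poly R},
    (forall s : R, s != 1 ->
      p.[s] = (1 - s) ^+ k * jacobi k 1 0 ((1 + s) / (1 - s)))
    /\ poissonised_charlier_moment theta k t =
         (theta ^+ k / k.+1%:R * p.[t])%:E.
Proof.
rewrite poissonised_charlier_momentE // hypergeometric_NN2; split=> //.
exists (\poly_(j < k.+1) ('C(k, j) * 'C(k.+1, j.+1))%:R); split=> [s s1|].
  by rewrite jacobi_transform // horner_poly.
congr (_%:E); rewrite horner_poly -mulrA; congr (_ * _).
rewrite mulr_sumr; apply: eq_bigr => j _; rewrite mulrA; congr (_ * _).
(* Absorption, (k + 1) C(k, j) = (j + 1) C(k + 1, j + 1), trades the 1/(j + 1) of the 2F1
   coefficient for the 1/(k + 1) in front of the Jacobi form. *)
have := mul_bin_diag k.+1 j => /= /(congr1 (fun i => i%:R : R)).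
rewrite !natrM => e.
have k0 : (k.+1%:R : R) != 0 by rewrite pnatr_eq0.
have j0 : (j.+1%:R : R) != 0 by rewrite pnatr_eq0.
rewrite (_ : 'C(k.+1, j.+1)%:R = k.+1%:R * 'C(k, j)%:R / j.+1%:R).
  by field; rewrite !nat1r k0 j0.
by rewrite e mulrC mulKf.
Qed.
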